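(* Let $\mu$ be a probability measure supported in a bounded interval of $\mathbb{R}$, and let $$u(t,x) \,=\, \frac{\int z\,e^{-zx/2 + z^2t/4} \,d\mu(z)}{\int e^{-zx/2 + z^2t/4} \,d\mu(z)}\,, \qquad t \in \mathbb{R}\,, \quad x \in \mathbb{R}\,.$$ If $c \in \mathrm{supp}(\mu)$, then $$\sup_{|x| \le L(t)} \bigl|u(t,x+ct) - c\bigr| \longrightarrow 0 \quad\text{as } t\to-\infty\,,$$ where $L : \mathbb{R}_- \to \mathbb{R}_+$ is any function such that $L(t)/|t| \to 0$ as $t \to -\infty$.
   Context: The function $u$ is a bounded entire solution of Burgers' equation $\partial_t u+u\,\partial_x u=\partial_x^2 u$. $\mathrm{supp}(\mu)$ denotes the closed support of $\mu$. *)

(* Defs.v *)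
From HB Require Import structures.
From mathcomp Require Import all_boot all_order all_algebra.
From mathcomp Require Import all_classical all_reals all_analysis.
Set Implicit Arguments.
Unset Strict Implicit.
Unset Printing Implicit Defensive.
Import Order.TTheory GRing.Theory Num.Theory.
Import numFieldNormedType.Exports.
Local Open Scope classical_set_scope.
Local Open Scope ring_scope.

Definition closed_support (R : realType)
    (mu : {measure set (measurableTypeR R) -> \bar R}) : set R :=
  [set c | forall U : set R, open U -> U c -> (0 < mu U)%E].

(* Both integrals are finite, and the denominator is positive, for every finite
   nonzero measure mu carried by a bounded set; the junk values of [Rintegral]
   and of division by 0 then play no role. *)
Definition burgers_u (R : realType)
    (mu : {measure set (measurableTypeR R) -> \bar R}) (t x : R) : R :=
  (\int[mu]_(z in setT) (z * expR (- (z * x) / 2 + z ^+ 2 * t / 4))) /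
  (\int[mu]_(z in setT) expR (- (z * x) / 2 + z ^+ 2 * t / 4)).

(* Main.v *)
Require Import Defs.
From HB Require Import structures.
From mathcomp Require Import all_boot all_order all_algebra.
From mathcomp Require Import all_classical all_reals all_analysis.
From mathcomp Require Import measurable_realfun ring lra.
Import Order.TTheory GRing.Theory Num.Theory.
Import numFieldNormedType.Exports.

(** The value [u(t, x)] is the mean of [z] against the probability density
    proportional to [weight t x z = exp (- z x / 2 + z^2 t / 4)].  Completing
    the square around [c] gives [weight_moving_frame]: at the point [x + c t]
    this density is proportional to [exp (- y x / 2 + y^2 t / 4)], where
    [y = z - c].  For [t] negative it is a Gaussian of width of order
    [|t|^(-1/2)], tilted by [x]; the tilt moves its centre by [|x| / |t|], which
    is negligible when [|x| <= L t].  Hence the mean of [y] tends to [0] as soon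
    as [mu] charges every neighbourhood of [c].

    Quantitatively (Laplace's method), fix [eps > 0] and assume that
    [|x| <= eps |t| / 8].  Up to the common normalisation, the weight is at most
    [exp (3/16 eps^2 t)] where [|y| >= eps] ([weight_far]), and at least
    [exp (1/32 eps^2 t)] where [|y| <= eps / 4] ([weight_near]).  The second
    exponent is closer to [0], and the ball of radius [eps / 4] around [c] has
    positive mass [m], so the far part of the mean is exponentially small
    compared with the total weight.  With [M] a bound of [|y|] on the support,
    [burgers_u_dist_le] gives
    [|u(t, x + c t) - c| <= eps + M / m * exp (5/32 eps^2 t)]
    uniformly in [x], since [3/16 - 1/32 = 5/32].  Letting [t] tend to
    minus infinity, and then [eps] to [0], proves the theorem. *)

Local Open Scope classical_set_scope.
Local Open Scope ring_scope.

Set Implicit Arguments.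
Unset Strict Implicit.

Lemma integrable_bounded_on_conull d (T : measurableType d) (R : realType)
    (mu : {finite_measure set T -> \bar R}) (D : set T) (f : T -> R) (K : R) :
  measurable D -> mu (~` D) = 0%E -> measurable_fun setT f ->
  (forall z, D z -> `|f z| <= K) -> mu.-integrable setT (EFin \o f).
Proof.
move=> mD muD mf fK.
apply/(negligible_integrable (measurableC mD) measurableT _ muD).
  exact/measurable_EFinP.
rewrite setTD setCK.
apply: measurable_bounded_integrable => //.
- by rewrite ltey_eq fin_num_measure.
- exact: measurable_funTS.
- exists K; split; first exact: num_real.
  by move=> M KM z Dz; apply: (le_trans (fK z Dz)); exact: ltW.
Qed.

Lemma Rintegral_conull d (T : measurableType d) (R : realType)
    (mu : {measure set T -> \bar R}) (D : set T) (f : T -> R) :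
  measurable D -> mu (~` D) = 0%E -> mu.-integrable setT (EFin \o f) ->
  \int[mu]_(z in setT) f z = \int[mu]_(z in D) f z.
Proof.
move=> mD muD intf; congr fine.
by rewrite (negligible_integral (measurableC mD) measurableT intf muD) setTD setCK.
Qed.

Lemma le_Rintegral_cst_subset d (T : measurableType d) (R : realType)
    (mu : {finite_measure set T -> \bar R}) (U : set T) (g : T -> R) (B : R) :
  measurable U -> mu.-integrable setT (EFin \o g) -> (forall z, 0 <= g z) ->
  (forall z, U z -> B <= g z) ->
  B * fine (mu U) <= \int[mu]_(z in setT) g z.
Proof.
move=> mU intg g0 gB.
rewrite -[in leRHS](setUv U) Rintegral_setU//; last 3 first.
- exact: measurableC.
- by rewrite setUv.
- by apply/disj_setPS; rewrite setICr.
rewrite -(Rintegral_cst mu mU) -[leLHS]addr0 lerD//; last exact: Rintegral_ge0.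
apply: le_Rintegral => //; first exact: finite_measure_integrable_cst.
exact: integrableS intg.
Qed.

(** The mean of [z] against a weight [g] is close to [c] when, away from [c],
    the weight is negligible compared with what it is on some set [U] of
    positive measure.  The distance to [c] is at most the weighted mean of
    [|z - c|]; the [eps] comes from the points near [c], and [A] bounds the
    contribution of all others, to be compared with the total weight, which is
    at least [B * mu U].  Writing the two contributions as one pointwise bound
    [eps * g + A] avoids cutting the integral into pieces. *)
Lemma weighted_mean_dist_le (R : realType) (mu : probability (measurableTypeR R) R)
    (D U : set R) (g : R -> R) (c eps A B : R) :
  measurable (D : set (measurableTypeR R)) -> mu (~` D) = 0%E ->
  measurable (U : set (measurableTypeR R)) -> (0 < mu U)%E ->
  mu.-integrable setT (EFin \o g) ->
  mu.-integrable setT (EFin \o (fun z => z * g z)) ->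
  (forall z, 0 <= g z) -> 0 <= A -> 0 < B ->
  (forall z, D z -> `|z - c| * g z <= eps * g z + A) ->
  (forall z, U z -> B <= g z) ->
  `|(\int[mu]_(z in setT) (z * g z)) / (\int[mu]_(z in setT) g z) - c|
    <= eps + A / (B * fine (mu U)).
Proof.
move=> mD muD mU muU intg intzg g0 A0 B0 gfar gnear.
have m0 : 0 < fine (mu U).
  by rewrite fine_gt0// muU /= (le_lt_trans (probability_le1 mu mU))// ltry.
have BmG := le_Rintegral_cst_subset mU intg g0 gnear.
set G := \int[mu]_(z in setT) g z in BmG *.
set N := \int[mu]_(z in setT) (z * g z).
have Bm0 : 0 < B * fine (mu U) by rewrite mulr_gt0.
have G0 : 0 < G by exact: lt_le_trans BmG.
have intcg : mu.-integrable setT (EFin \o (fun z => c * g z)).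
  exact: (integrableZl measurableT c intg).
have intdiff : mu.-integrable setT (EFin \o (fun z => (z - c) * g z)).
  have := integrableB measurableT intzg intcg.
  by apply: eq_integrable => // z _ /=; rewrite mulrBl.
have NcG : N - c * G = \int[mu]_(z in setT) ((z - c) * g z).
  rewrite -RintegralZl// -RintegralB//.
  by apply: eq_Rintegral => z _; rewrite mulrBl.
have intD f : mu.-integrable setT (EFin \o f) -> mu.-integrable D (EFin \o f).
  exact: integrableS.
have intA : \int[mu]_(z in D) A = A.
  have muD1 : fine (mu D) = 1.
    by rewrite -[D]setCK probability_setC ?muD ?sube0//; exact: measurableC.
  by rewrite -[RHS]mulr1 -muD1; exact: Rintegral_cst.
have NcG_le : `|N - c * G| <= eps * G + A.
  rewrite NcG (Rintegral_conull mD muD intdiff).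
  apply: (le_trans (le_normr_Rintegral mD (intD _ intdiff))).
  have -> : eps * G + A = \int[mu]_(z in D) (eps * g z + A).
    rewrite RintegralD//; last 2 first.
    - exact: (integrableZl mD eps (intD _ intg)).
    - exact: finite_measure_integrable_cst.
    rewrite RintegralZl//; last exact: intD.
    by rewrite intA /G (Rintegral_conull mD muD intg).
  apply: le_Rintegral => //.
  - exact/integrable_norm/intD.
  - have := integrableD mD (integrableZl mD eps (intD _ intg))
      (finite_measure_integrable_cst mu A mD).
    by apply: eq_integrable.
  - by move=> z Dz; rewrite normrM (ger0_norm (g0 z)) gfar.
have -> : N / G - c = (N - c * G) / G by rewrite mulrBl mulfK ?gt_eqF.
rewrite normrM normfV (gtr0_norm G0) ler_pdivrMr//.
apply: (le_trans NcG_le); rewrite mulrDl lerD2l mulrAC ler_pdivlMr//.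
exact: ler_wpM2l.
Qed.

(** Unnormalised density whose mean is [burgers_u]; in Cole-Hopf terms, the
    exponential solution of the heat equation attached to the speed [z]. *)
Definition weight {R : realType} (t x z : R) : R :=
  expR (- (z * x) / 2 + z ^+ 2 * t / 4).

Lemma measurable_weight (R : realType) (t x : R) :
  measurable_fun [set: measurableTypeR R] (weight t x).
Proof.
apply: measurableT_comp => //; apply: measurable_funD.
  apply: measurable_funM => //; apply: measurableT_comp => //.
  exact: measurable_funM.
by do 2 apply: measurable_funM => //.
Qed.

(** A crude bound on a bounded set of speeds, from which the integrability
    of the weight follows. *)
Lemma weight_le (R : realType) (t x K z : R) : `|z| <= K ->
  weight t x z <= expR (K * `|x| / 2 + K ^+ 2 * `|t| / 4).
Proof.
move=> zK; rewrite ler_expR lerD// ler_pM2r ?invr_gt0//.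
- rewrite (le_trans (ler_norm _))// normrN normrM.
  exact: ler_wpM2r.
- rewrite (le_trans (ler_norm _))// normrM normrX ler_wpM2r// lerXn2r ?nnegrE//.
  exact: le_trans zK.
Qed.

(** Galilean invariance: moving with speed [c] recentres the speeds at [c], up
    to a factor that does not depend on [z] and so cancels in the mean. *)
Lemma weight_moving_frame (R : realType) (c t x z : R) :
  weight t (x + c * t) z =
  expR (- (c * x) / 2 - c ^+ 2 * t / 4) * weight t x (z - c).
Proof. by rewrite /weight -expRD; congr expR; field. Qed.

(** The condition on [x] makes the tilt [- y x / 2] at most a quarter of the
    Gaussian exponent [y^2 |t| / 4] when [|y| >= eps], whence three quarters of
    [eps^2 / 4] remain. *)
Lemma weight_far (R : realType) (t x eps y : R) : t < 0 -> 0 < eps ->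
  `|x| <= eps / 8 * `|t| -> eps <= `|y| ->
  weight t x y <= expR (3 / 16 * eps ^+ 2 * t).
Proof.
move=> t0 eps0 xle epsy; rewrite ler_expR.
rewrite (ltr0_norm t0) in xle.
have yx : - (y * x) <= `|y| * (eps / 8 * - t).
  by rewrite (le_trans (ler_norm _))// normrN normrM ler_wpM2l.
rewrite -[y ^+ 2]real_normK ?num_real//.
set a := `|y| in epsy yx *.
(* This product is [(a^2 - a eps / 4 - 3/4 eps^2) |t|], the gap to be shown
   nonnegative, up to a factor 4. *)
have : 0 <= (a - eps) * (a + 3 / 4 * eps) * - t.
  by apply: mulr_ge0; [apply: mulr_ge0|]; lra.
nra.
Qed.

(** On [|y| <= eps / 4] the Gaussian and the tilt cost at most
    [eps^2 |t| / 64] each, well below the decay obtained in [weight_far]. *)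
Lemma weight_near (R : realType) (t x eps y : R) : t < 0 -> 0 < eps ->
  `|x| <= eps / 8 * `|t| -> `|y| <= eps / 4 ->
  expR (1 / 32 * eps ^+ 2 * t) <= weight t x y.
Proof.
move=> t0 eps0 xle yeps; rewrite ler_expR.
rewrite (ltr0_norm t0) in xle.
have yx : y * x <= eps / 4 * (eps / 8 * - t).
  by rewrite (le_trans (ler_norm _))// normrM ler_pM.
have y2 : y ^+ 2 <= (eps / 4) ^+ 2.
  by rewrite -[y ^+ 2]real_normK ?num_real// lerXn2r ?nnegrE ?divr_ge0// ltW.
nra.
Qed.

(** [weighted_mean_dist_le] with [U] the ball of radius [eps / 4] around [c];
    the Galilean factor occurs in both [A] and [B], so that only the ratio of
    the two exponentials survives.  The bound does not involve [x], hence
    passes to the supremum over [x]. *)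
Lemma burgers_u_dist_le (R : realType) (mu : probability (measurableTypeR R) R)
    (D : set R) (K M c t x eps : R) :
  measurable (D : set (measurableTypeR R)) -> mu (~` D) = 0%E ->
  (forall z, D z -> `|z| <= K) -> (forall z, D z -> `|z - c| <= M) -> 0 <= M ->
  (0 < mu (ball c (eps / 4)))%E ->
  t < 0 -> 0 < eps -> `|x| <= eps / 8 * `|t| ->
  `|burgers_u mu t (x + c * t) - c| <=
    eps + M / fine (mu (ball c (eps / 4))) * expR (5 / 32 * eps ^+ 2 * t).
Proof.
move=> mD muD DK DM M0 muB t0 eps0 xle.
have mB : measurable (ball c (eps / 4) : set (measurableTypeR R)).
  exact: measurable_ball.
set C := expR (- (c * x) / 2 - c ^+ 2 * t / 4).
have C0 : 0 < C by exact: expR_gt0.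
have C_ge0 := ltW C0.
have eps_ge0 := ltW eps0.
have mw := measurable_weight t (x + c * t).
have wK z : D z -> `|weight t (x + c * t) z| <=
    expR (K * `|x + c * t| / 2 + K ^+ 2 * `|t| / 4).
  by move=> /DK zK; rewrite ger0_norm ?expR_ge0// weight_le.
have intw := integrable_bounded_on_conull mD muD mw wK.
have intzw : mu.-integrable setT
    (EFin \o (fun z => z * weight t (x + c * t) z)).
  apply: (integrable_bounded_on_conull
    (K := K * expR (K * `|x + c * t| / 2 + K ^+ 2 * `|t| / 4)) mD muD).
    exact: measurable_funM.
  by move=> z Dz; rewrite normrM ler_pM// ?DK// wK.
(* Where [|z - c| <= eps] the first term is enough; elsewhere the second. *)
have far z : D z -> `|z - c| * weight t (x + c * t) z <=
    eps * weight t (x + c * t) z + C * M * expR (3 / 16 * eps ^+ 2 * t).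
  move=> Dz; have [yeps|/ltW yeps] := leP `|z - c| eps.
    rewrite -[leLHS]addr0 lerD//; first by rewrite ler_wpM2r ?expR_ge0.
    by rewrite !mulr_ge0 ?expR_ge0.
  rewrite -[leLHS]add0r lerD//; first by rewrite mulr_ge0 ?expR_ge0.
  rewrite weight_moving_frame -/C mulrCA -mulrA ler_pM2l// ler_pM ?expR_ge0 ?DM//.
  exact: weight_far.
have near z : ball c (eps / 4) z ->
    C * expR (1 / 32 * eps ^+ 2 * t) <= weight t (x + c * t) z.
  rewrite /ball /= distrC => /ltW yeps.
  by rewrite weight_moving_frame ler_pM2l// weight_near.
have -> : burgers_u mu t (x + c * t) =
  (\int[mu]_(z in setT) (z * weight t (x + c * t) z)) /
  (\int[mu]_(z in setT) weight t (x + c * t) z) by [].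
apply: (le_trans (weighted_mean_dist_le mD muD mB muB intw intzw _ _ _ far near)).
- by move=> z; exact: expR_ge0.
- by rewrite !mulr_ge0 ?expR_ge0.
- by rewrite mulr_gt0 ?expR_gt0.
rewrite lerD2l.
have -> : 3 / 16 * eps ^+ 2 * t =
  5 / 32 * eps ^+ 2 * t + 1 / 32 * eps ^+ 2 * t by field.
have m0 : 0 < fine (mu (ball c (eps / 4))).
  by rewrite fine_gt0// muB /= (le_lt_trans (probability_le1 mu mB))// ltry.
rewrite expRD le_eqVlt; apply/orP; left; apply/eqP; field.
by rewrite !gt_eqF ?expR_gt0.
Qed.

(** Only [1 + s <= exp s] is used: [a exp (k t) <= a / (1 + k |t|)], so any
    [t <= - a / (k e)] will do. *)
Lemma cst_mul_expR_small (R : realType) (a k e : R) : 0 <= a -> 0 < k -> 0 < e ->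
  \forall t \near -oo, a * expR (k * t) <= e.
Proof.
move=> a0 k0 e0; near=> t.
have t_le : t <= - (a / (k * e)).
  by near: t; apply: nbhs_ninfty_le; exact: num_real.
rewrite -[k * t]opprK expRN ler_pdivrMr ?expR_gt0//.
apply: le_trans (_ : a <= e * (1 + - (k * t))) _; last first.
  by rewrite ler_wpM2l ?expR_ge1Dx// ltW.
have : a / (k * e) * (k * e) <= - t * (k * e).
  by rewrite ler_pM2r ?mulr_gt0// lerNr.
rewrite divfK ?gt_eqF ?mulr_gt0//.
nra.
Unshelve. all: by end_near. Qed.

Theorem proposition5p6 (R : realType) (mu : probability (measurableTypeR R) R)
    (I : interval R) (I_bounded : bounded_set [set` I])
    (mu_I : mu (~` [set` I]) = 0%E)
    (c : R) (c_supp : closed_support mu c)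
    (L : R -> R) (L_ge0 : forall t : R, t < 0 -> 0 <= L t)
    (L_small : L t / `|t| @[t --> -oo] --> (0 : R)) :
  ereal_sup [set (`|burgers_u mu t (x + c * t) - c|)%:E | x in [set x : R | `|x| <= L t]]
    @[t --> -oo] --> (0 : \bar R)%E.
Proof.
have [K0 [_ IK0]] := I_bounded.
pose K := `|K0| + 1.
have IK z : [set` I] z -> `|z| <= K.
  by move=> Iz; apply: IK0 => //; rewrite /K (le_lt_trans (ler_norm _))// ltrDl.
have IM z : [set` I] z -> `|z - c| <= K + `|c|.
  by move=> Iz; rewrite (le_trans (ler_normB _ _))// lerD2r IK.
have M0 : 0 <= K + `|c| by rewrite !addr_ge0.
have mI : measurable ([set` I] : set (measurableTypeR R)) by exact: measurable_itv.
set S := fun t => ereal_sup _.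
(* The supremum is not the one of an empty set: [x = 0] is always allowed. *)
have S_ge0 t : t < 0 -> (0 <= S t)%E.
  move=> t0; apply: (@le_trans _ _ (`|burgers_u mu t (0 + c * t) - c|)%:E).
    by rewrite lee_fin.
  by apply: ereal_sup_ubound; exists 0 => //=; rewrite normr0 L_ge0.
(* Half of [eps] is the radius of localisation, the other half pays for the
   exponentially small remainder. *)
have S_le eps : 0 < eps -> \forall t \near -oo, (S t <= eps%:E)%E.
  move=> eps0; pose e := eps / 2.
  have e0 : 0 < e by rewrite divr_gt0.
  have muB : (0 < mu (ball c (e / 4)))%E.
    by apply: c_supp; [exact: ball_open|apply: ballxx; rewrite divr_gt0].
  near=> t.
  have t0 : t < 0 by near: t; apply: nbhs_ninfty_lt; exact: num_real.
  apply: ge_ereal_sup => _ [x /= xL <-]; rewrite lee_fin.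
  have xle : `|x| <= e / 8 * `|t|.
    rewrite (le_trans xL)// -ler_pdivrMr ?normr_gt0 ?lt_eqF//.
    rewrite (le_trans (ler_norm _))//.
    near: t; apply: cvgr0_norm_le => //.
    by rewrite divr_gt0.
  apply: (le_trans (burgers_u_dist_le mI mu_I IK IM M0 muB t0 e0 xle)).
  have -> : eps = e + e by rewrite -splitr.
  rewrite lerD2l; near: t; apply: cst_mul_expR_small => //.
    by rewrite divr_ge0 ?fine_ge0.
  by rewrite mulr_gt0// exprn_gt0.
apply/fine_cvgP; split.
  near=> t; rewrite ge0_fin_numE.
    by rewrite (@le_lt_trans _ _ 1%:E) ?ltry//; near: t; apply: S_le.
  by apply: S_ge0; near: t; apply: nbhs_ninfty_lt; exact: num_real.
apply/cvgrPdist_le => eps eps0; near=> t.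
have t0 : t < 0 by near: t; apply: nbhs_ninfty_lt; exact: num_real.
have St : (S t <= eps%:E)%E by near: t; apply: S_le.
rewrite sub0r normrN /= ger0_norm ?fine_ge0 ?S_ge0//.
by rewrite -lee_fin fineK// ge0_fin_numE ?S_ge0// (le_lt_trans St)// ltry.
Unshelve. all: by end_near. Qed.
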